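(* Let $r\ge3$ be a positive integer. Then there exists a locally flexible dense rod-pin mesh in $\mathbb{R}^2$ such that the degree of every node is $r$.
   Context: A line segment string-node mesh $\mathcal{M}=(N,S)$ in $\mathbb{R}^2$ is a pair of sets such that: $S$ (the strings) is a nonempty finite or countable set of lines, closed (nondegenerate) line segments or closed semi-infinite line segments, distinct collinear strings being disjoint; $N$ (the nodes) is nonempty, finite or countable, and is the set of intersection points of (distinct) strings; and $l\cap N$ is dense in $l$ for each string $l$. The body $|\mathcal{M}|$ is the union of the strings. The mesh is dense if its nodes are dense in $\mathbb{R}^2$. The degree of a node $p$ is the number of path-connected components of $X_\rho(p)\setminus\{p\}$ (for small $\rho>0$), where $X_\rho(p)$ is the union of the sets $l\cap B(p,\rho)$ over strings $l$ containing $p$ and $B(p,\rho)$ is the closed ball of radius $\rho$ centred at $p$. A placement of $\mathcal{M}$ is an injective map $p:|\mathcal{M}|\to\mathbb{R}^2$ whose restriction to each string is continuous and length preserving (the length of the image path of each subsegment of a string equals the length of the subsegment). A continuous flex of $\mathcal{M}$ is a pointwise continuous path $t\mapsto p_t$, $t\in[0,1]$, of placements, starting at the identity placement. A rod-pin mesh is a line segment string-node mesh whose strings are regarded as inflexible rods; a pair of rods may be joined at a node which is an endpoint of both, an endpoint of one and an interior point of the other, or an interior point of both. A flex of a rod-pin mesh is a continuous flex of the associated line segment mesh such that the restriction of each $p_t$ to each string is isometric (for the Euclidean metric). A mesh $\mathcal{M}$ is locally flexible if there exist a bounded open set $U\subset\mathbb{R}^2$ and a path of homeomorphisms $p_t$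 of $\mathbb{R}^2$, $t\in[0,1]$, such that $(p_t)$ (restricted to $|\mathcal{M}|$) is a nontrivial flex of $\mathcal{M}$ (i.e. the restrictions $p_t|_{|\mathcal{M}|}$ are not all restrictions of isometries of $\mathbb{R}^2$) and $p_t(x,y)=(x,y)$ for all points $(x,y)$ in the complement of $U$. For a rod-pin mesh the flex is required to be a flex in the rod-pin sense. *)

(* Defs.v *)
From HB Require Import structures.
From mathcomp Require Import all_boot all_order all_algebra.
From mathcomp Require Import all_classical all_reals all_analysis.

Set Implicit Arguments.
Unset Strict Implicit.
Unset Printing Implicit Defensive.

Import Order.TTheory GRing.Theory Num.Theory.
Import numFieldNormedType.Exports.

Local Open Scope classical_set_scope.
Local Open Scope ring_scope.

(* The norm of the product [R * R] is the sup norm: it gives the usual topology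
   and bounded sets, but all metric notions below use [edist]. *)
Notation plane R := (R * R)%type.

Section Geometry.
Context {R : realType}.
Implicit Types (x y a b : plane R) (A l m : set (plane R)).

Definition edist x y : R := Num.sqrt ((x.1 - y.1) ^+ 2 + (x.2 - y.2) ^+ 2).

Definition isometry_on A (f : plane R -> plane R) : Prop :=
  forall x y, A x -> A y -> edist (f x) (f y) = edist x y.

Definition homeomorphism (f : plane R -> plane R) : Prop :=
  exists g : plane R -> plane R,
    [/\ continuous f, continuous g, cancel f g & cancel g f].

(* Length of a parametrised path over the parameter interval [u, v]: supremum
   of the lengths of inscribed polygons (cf. [variation] for real functions). *)
Definition path_length (u v : R) (f : R -> plane R) : \bar R :=
  ereal_sup [set (\sum_(0 <= n < size s)
      edist (f (nth v (u :: s) n)) (f (nth v (u :: s) n.+1)))%:E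
    | s in itv_partition u v].

Definition joined_in A x y : Prop :=
  exists f : R -> plane R,
    [/\ {within `[0, 1], continuous f}, f 0 = x, f 1 = y
      & forall t, 0 <= t <= 1 -> A (f t)].

Definition path_components A : set (set (plane R)) :=
  [set joined_in A x | x in A].

Definition affine_path a b (t : R) : plane R := a + t *: (b - a).

Definition full_line a b : set (plane R) := range (affine_path a b).

Definition half_line a b : set (plane R) :=
  [set affine_path a b t | t in [set t | 0 <= t]].

Definition segment a b : set (plane R) :=
  [set affine_path a b t | t in [set t | 0 <= t <= 1]].

Definition string l : Prop :=
  exists a b, a <> b /\
    [\/ l = full_line a b, l = segment a b | l = half_line a b].

Definition collinear l m : Prop :=
  exists a b, [/\ a <> b, l `<=` full_line a b & m `<=` full_line a b].

End Geometry.

Record mesh (R : realType) := Mesh {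
  nodes : set (plane R);
  strings : set (set (plane R));
  strings_nonempty : strings !=set0;
  strings_countable : countable strings;
  stringsP : forall l, strings l -> string l;
  strings_collinear : forall l m, strings l -> strings m -> l <> m ->
    collinear l m -> l `&` m = set0;
  nodesE : nodes =
    [set x | exists l m, [/\ strings l, strings m, l <> m, l x & m x]];
  nodes_nonempty : nodes !=set0;
  nodes_countable : countable nodes;
  nodes_dense_in : forall l, strings l -> l `<=` closure (l `&` nodes)
}.

(* A rod-pin mesh is the same object, the rigidity of its strings being imposed
   on its flexes ([rod_pin_flex]). The permitted joints (end to end, end to
   interior, interior to interior) exhaust the ways in which two strings can
   meet, so they impose no further condition. *)
Notation rod_pin_mesh := mesh.

Section Mesh.
Context {R : realType}.
Implicit Types (M : mesh R) (x : plane R) (p : R -> plane R -> plane R).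

Definition body M : set (plane R) := \bigcup_(l in strings M) l.

Definition dense_mesh M : Prop := dense (nodes M).

Definition star M x (rho : R) : set (plane R) :=
  [set y | exists l, [/\ strings M l, l x, l y & edist x y <= rho]].

Definition has_degree M x (r : nat) : Prop :=
  \forall rho \near (0 : R)^'+,
    (path_components (star M x rho `\ x) #= `I_r)%card.

(* Maps of the body are represented by total functions on the plane, of which
   only the values on [body M] matter. *)
Definition placement M (f : plane R -> plane R) : Prop :=
  [/\ forall x y, body M x -> body M y -> f x = f y -> x = y,
      forall l, strings M l -> {within l, continuous f}
    & forall l a b, strings M l -> l a -> l b ->
        path_length 0 1 (f \o affine_path a b) = (edist a b)%:E].

Definition continuous_flex M p : Prop :=
  [/\ forall t, 0 <= t <= 1 -> placement M (p t),
      forall x, body M x -> p 0 x = x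
    & forall x, body M x -> {within `[0, 1], continuous (p ^~ x)}].

Definition rod_pin_flex M p : Prop :=
  continuous_flex M p /\
  forall t l, 0 <= t <= 1 -> strings M l -> isometry_on l (p t).

Definition nontrivial_flex M p : Prop :=
  ~ forall t, 0 <= t <= 1 ->
      exists g : plane R -> plane R,
        isometry_on setT g /\ forall x, body M x -> p t x = g x.

(* A path in the homeomorphism group of the plane (compact-open topology) is
   given by a family which is jointly continuous in time and space. *)
Definition homeomorphism_path p : Prop :=
  (forall t, 0 <= t <= 1 -> homeomorphism (p t)) /\
  {within `[0, 1] `*` setT, continuous (uncurry p)}.

(* Local flexibility in the rod-pin sense. *)
Definition locally_flexible M : Prop :=
  exists (U : set (plane R)) p,
    [/\ open U, bounded_set U, homeomorphism_path p,
        rod_pin_flex M p /\ nontrivial_flex M p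
      & forall t x, 0 <= t <= 1 -> ~ U x -> p t x = x].

End Mesh.

(* Main.v *)
From mathcomp Require Import all_boot all_order all_algebra.
From mathcomp Require Import all_classical all_reals all_analysis.
From mathcomp Require Import ring lra.
Require Import Defs.

(* The plane is twisted: the circle of squared radius s is rotated by the angle
   t * c(s), where c is a continuous "devil's staircase": it vanishes for
   s >= 2, is positive at s = 1, and is constant near every rational number.
   Then the plane has a dense open subset, covered by open cells on each of
   which every twist coincides with a rotation, so every string contained in a
   cell is moved isometrically.

   A dense mesh of segments, each contained in a cell, is the increasing union
   of finite configurations. A configuration grows in two ways: a short segment
   is added in a given open set, away from all the others; or, at a point p
   interior to one string and on no other, r - 2 short segments starting at p
   are attached on one side of that string, which makes p a node of degree r.
   New strings avoid the earlier nodes, so degrees never change, and enumerating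
   a countable base makes the nodes dense in the plane and in every string. *)

Set Implicit Arguments.
Unset Strict Implicit.
Unset Printing Implicit Defensive.

Import Order.TTheory GRing.Theory Num.Theory.
Import numFieldNormedType.Exports.

Local Open Scope classical_set_scope.
Local Open Scope ring_scope.

(** * The plane and its segments *)

Section PlaneTopology.
Context {R : realType}.
Implicit Types (x y a b : plane R) (V W : set (plane R)).

Lemma plane_open_box V x : open V -> V x ->
  exists2 e : R, 0 < e &
    forall y, `|x.1 - y.1| < e -> `|x.2 - y.2| < e -> V y.
Proof.
move=> oV Vx; have /nbhs_ballP[e e0 eV] : nbhs x V by exact: open_nbhs_nbhs.
by exists e => // y y1 y2; apply: eV; split.
Qed.

Lemma rat_approx (s e : R) : 0 < e -> exists q : rat, `|ratr q - s| < e.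
Proof.
move=> e0; have [|q] := @rat_in_itvoo R (s - e) (s + e); first by lra.
by rewrite in_itv/= => qe; exists q; rewrite ltr_norml; lra.
Qed.

Lemma open_plane_rat V : open V -> V !=set0 ->
  exists q1 q2 : rat, V (ratr q1, ratr q2).
Proof.
move=> oV [x Vx]; have [e e0 eV] := plane_open_box oV Vx.
have [q1 q1e] := rat_approx x.1 e0; have [q2 q2e] := rat_approx x.2 e0.
by exists q1, q2; apply: eV; rewrite distrC.
Qed.

Lemma plane_countable_base : exists B : nat -> set (plane R),
  (forall n, open (B n)) /\
  forall x V, open V -> V x -> exists2 n, B n x & B n `<=` V.
Proof.
pose B n : set (plane R) :=
  if (unpickle n : option (rat * rat * rat)) is Some q
  then ball ((ratr q.1.1, ratr q.1.2) : plane R) (ratr q.2) else set0.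
exists B; split.
  by move=> n; rewrite /B; case: unpickle => [q|]; [exact: ball_open|exact: open0].
move=> x V oV Vx; have [e e0 eV] := plane_open_box oV Vx.
(* With [d] below [e / 2], a ball of radius [d] whose centre is [d]-close to [x] stays within [e] of
   [x]. *)
have [d] : exists d : rat, ratr d \in `]0, e / 2[.
  by apply: (@rat_in_itvoo R); rewrite divr_gt0.
rewrite in_itv/= => /andP[d0 de].
have [q1 q1e] := rat_approx x.1 d0; have [q2 q2e] := rat_approx x.2 d0.
exists (pickle (q1, q2, d)); rewrite /B pickleK; first by split.
move=> y [/= y1 y2]; apply: eV.
- by rewrite (le_lt_trans (ler_distD (ratr q1) _ _))// distrC; move: y1; rewrite /ball/=; lra.
- by rewrite (le_lt_trans (ler_distD (ratr q2) _ _))// distrC; move: y2; rewrite /ball/=; lra.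
Qed.

End PlaneTopology.

(** Induction on the finite index set: each new [F i] contributes one open dense complement, and
    intersecting with an open dense set preserves density. *)
Lemma open_dense_setC_bigcup (T : topologicalType) (I : choiceType)
    (D : set I) (F : I -> set T) : finite_set D ->
  (forall i, D i -> closed (F i)) -> (forall i, D i -> dense (~` F i)) ->
  open (~` \bigcup_(i in D) F i) /\ dense (~` \bigcup_(i in D) F i).
Proof.
move=> finD cF dF; split; first by apply/closed_openC/closed_bigcup.
move: finD cF dF => /finite_seqP[s ->].
elim: s => [_ _ V [x Vx] _|i s IH cF dF]; first by exists x; split => // -[].
have si j : [set` s] j -> [set` i :: s] j by rewrite /= inE orbC => ->.
have -> : ~` (\bigcup_(j in [set` i :: s]) F j) =
    ~` F i `&` ~` (\bigcup_(j in [set` s]) F j).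
  apply/seteqP; split=> x /= H.
    split=> [Fx|[j js Fx]]; apply: H; first by exists i => //=; exact: mem_head.
    by exists j => //; exact: si.
  case: H => nFi nFs [j]; rewrite /= inE => /orP[/eqP -> //|js Fx].
  by apply: nFs; exists j.
apply: denseI.
- by apply/closed_openC/cF => /=; exact: mem_head.
- by apply/dF => /=; exact: mem_head.
- by apply: IH => j /si; [exact: cF|exact: dF].
Qed.

Lemma finite_setC_dense (R : realType) (D : set R) :
  finite_set D -> dense (~` D).
Proof.
move=> finD; rewrite -[D]image_id -bigcup_imset1.
apply: (open_dense_setC_bigcup finD _ _).2 => i _.
  exact: closed_eq.
exact: dense_set1C.
Qed.

(** * Segments, cross products and collinearity *)

Section Segments.
Context {R : realType}.
Implicit Types (x y z a b p u : plane R) (l m : set (plane R)) (s t : R).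

Definition cross u v : R := u.1 * v.2 - u.2 * v.1.
Definition dot u v : R := u.1 * v.1 + u.2 * v.2.

Lemma affine_pathE a b t :
  affine_path a b t = (a.1 + t * (b.1 - a.1), a.2 + t * (b.2 - a.2)).
Proof. by []. Qed.

Lemma planeP x y : x.1 = y.1 -> x.2 = y.2 -> x = y.
Proof. by case: x y => [x1 x2] [y1 y2] /= -> ->. Qed.

Lemma dot_gt0 u : u <> 0 -> 0 < dot u u.
Proof.
case: u => u1 u2 u0; rewrite /dot/= lt_neqAle; apply/andP; split; last by nra.
apply/eqP => /esym/eqP; rewrite paddr_eq0 -?expr2 ?sqr_ge0// !sqrf_eq0.
by move=> /andP[/eqP e1 /eqP e2]; apply: u0; rewrite e1 e2.
Qed.

Lemma continuous_pair (T : topologicalType) (f g : T -> R) :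
  continuous f -> continuous g -> continuous (fun i => (f i, g i)).
Proof. by move=> cf cg i; exact: (cvg_pair (cf i) (cg i)). Qed.

Lemma continuous_affine_path a b : continuous (affine_path a b).
Proof.
apply: continuous_pair => t; apply: cvgD; try exact: cvg_cst;
  by apply: cvgMl; exact: cvg_id.
Qed.

Lemma continuous_cross u a : continuous (fun x => cross u (x - a)).
Proof.
move=> x; apply: cvgB; apply: cvgMr; apply: cvgB; try exact: cvg_cst;
  [exact: cvg_snd|exact: cvg_fst].
Qed.

Lemma segment_cross a b x : segment a b x -> cross (b - a) (x - a) = 0.
Proof. by move=> [t _ <-]; rewrite affine_pathE /cross /=; ring. Qed.

Lemma full_line_cross a b x y z : full_line a b x -> full_line a b y ->
  full_line a b z -> cross (y - x) (z - x) = 0.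
Proof.
by move=> [t _ <-] [s _ <-] [w _ <-]; rewrite !affine_pathE /cross /=; ring.
Qed.

Lemma closed_segment a b : closed (segment a b).
Proof.
apply: compact_closed; first exact: norm_hausdorff.
have -> : segment a b = affine_path a b @` `[0, 1].
  by rewrite /segment; congr image; apply/seteqP; split=> t /=; rewrite in_itv.
apply: continuous_compact; last exact: segment_compact.
exact/continuous_subspaceT/continuous_affine_path.
Qed.

(** An open box inside the segment would contain [x] and its shifts by [e / 2] along both axes.
    Comparing their equations [cross (b - a) (_ - a) = 0] kills both coordinates of [b - a]. *)
Lemma dense_setC_segment a b : a <> b -> dense (~` segment a b).
Proof.
move=> ab V [x Vx] oV; have [e e0 eV] := plane_open_box oV Vx.
apply/set0P/eqP => VS0.
have inV y : V y -> segment a b y.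
  by move=> Vy; apply: contrapT => nS; have : (V `&` ~` segment a b) y by []; rewrite VS0.
have e2 : `|e / 2| < e by rewrite ger0_norm; lra.
have x1 : cross (b - a) (x + (e / 2, 0) - a) = 0.
  apply/segment_cross/inV/eV => /=; first by rewrite opprD addNKr normrN.
  by rewrite addr0 subrr normr0.
have x2 : cross (b - a) (x + (0, e / 2) - a) = 0.
  apply/segment_cross/inV/eV => /=; last by rewrite opprD addNKr normrN.
  by rewrite addr0 subrr normr0.
have := segment_cross (inV _ Vx).
move: x1 x2; rewrite /cross /= !addr0 => x1 x2 x0; apply: ab; apply: planeP.
  have /eqP : (b.1 - a.1) * (e / 2) = 0 by lra.
  by rewrite mulf_eq0 => /orP[/eqP|/eqP]; lra.
have /eqP : (b.2 - a.2) * (e / 2) = 0 by lra.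
by rewrite mulf_eq0 => /orP[/eqP|/eqP]; lra.
Qed.

Lemma segmentl a b : segment a b a.
Proof. by exists 0; [by rewrite /= lexx ler01|]; apply: planeP; rewrite affine_pathE /=; ring. Qed.

Lemma segmentr a b : segment a b b.
Proof. by exists 1; [by rewrite /= lexx ler01|]; apply: planeP; rewrite affine_pathE /=; ring. Qed.

Lemma affine_path_inj a b : a <> b -> injective (affine_path a b).
Proof.
move=> ab s t [/eqP e1 /eqP e2]; apply: contrapT => /eqP; rewrite -subr_eq0 => st.
have f1 : (s - t) * (b.1 - a.1) = 0 by move: e1 => /eqP/=; rewrite /GRing.scale/=; lra.
have f2 : (s - t) * (b.2 - a.2) = 0 by move: e2 => /eqP/=; rewrite /GRing.scale/=; lra.
move: f1 f2 => /eqP + /eqP; rewrite !mulf_eq0 (negPf st) /= => /eqP f1 /eqP f2.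
by apply: ab; apply: planeP; lra.
Qed.

Lemma segment_convex a b x y : segment a b x -> segment a b y ->
  segment x y `<=` segment a b.
Proof.
move=> [s s01 <-] [t t01 <-] z [w w01 <-].
exists (s + w * (t - s)); last by apply: planeP; rewrite !affine_pathE /=; ring.
move: s01 t01 w01 => /= /andP[s0 s1] /andP[t0 t1] /andP[w0 w1].
have w1' : 0 <= 1 - w by lra.
have := mulr_ge0 w0 t0; have := mulr_ge0 w1' s0.
have : 0 <= w * (1 - t) by apply: mulr_ge0 => //; lra.
have : 0 <= (1 - w) * (1 - s) by apply: mulr_ge0 => //; lra.
by move=> *; apply/andP; split; lra.
Qed.

Lemma segment_sub_full_line a b x y : x <> y -> segment a b x ->
  segment a b y -> segment a b `<=` full_line x y.
Proof.
move=> xy [s _ sx] [t _ ty] z [w _ <-].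
have ts : t - s != 0.
  by apply: contra_notN xy => /eqP ts; rewrite -sx -ty; congr affine_path; lra.
exists ((w - s) / (t - s)) => //.
by rewrite -sx -ty; apply: planeP; rewrite !affine_pathE /=; field.
Qed.

(** Two distinct common points would span a line containing both segments. *)
Lemma meet_not_collinear a b c d x y : ~ collinear (segment a b) (segment c d) ->
  segment a b x -> segment c d x -> segment a b y -> segment c d y -> x = y.
Proof.
move=> nc ax cx ay cy; apply: contrapT => xy; apply: nc.
by exists x, y; split => //; exact: segment_sub_full_line.
Qed.

Lemma not_collinear_cross l m x y z : l x -> l y -> m x -> m z ->
  cross (y - x) (z - x) != 0 -> ~ collinear l m.
Proof.
move=> lx ly mx mz /eqP nz [a [b [_ la mb]]]; apply: nz.
by apply: (@full_line_cross a b); auto.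
Qed.

End Segments.

(** * Path components of a fan *)

Section Degree.
Context {R : realType}.
Implicit Types (x y z a b p u : plane R) (l m A : set (plane R)) (s t e : R).

(** Were the ends different, the intermediate value theorem would give every value between them, but
    a finite set contains no interval. *)
Lemma finite_range_continuous_const (f : R -> R) (F : set R) :
  {within `[0, 1], continuous f} -> finite_set F ->
  (forall s, 0 <= s <= 1 -> F (f s)) -> f 0 = f 1.
Proof.
move=> cf finF fF; apply: contrapT => /eqP f01.
pose m := Num.min (f 0) (f 1); pose M := Num.max (f 0) (f 1).
have mM : m < M by rewrite /m /M; case: (ltgtP (f 0) (f 1)) f01.
have [||c [/= + nFc]] := finite_setC_dense finF (O := `]m, M[%classic).
- by exists ((m + M) / 2) => /=; rewrite in_itv/=; apply/andP; split; lra.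
- exact: itv_open.
rewrite in_itv /= => /andP[/ltW c1 /ltW c2]; apply: nFc.
have [|s] := @IVT _ f 0 1 c ler01 cf; first by rewrite c1.
by rewrite in_itv/= => s01 <-; exact: fF.
Qed.

Lemma affine_path0 a b : affine_path a b 0 = a.
Proof. by apply: planeP; rewrite affine_pathE /=; ring. Qed.

Lemma affine_path1 a b : affine_path a b 1 = b.
Proof. by apply: planeP; rewrite affine_pathE /=; ring. Qed.

(* The values of [h] label the path components of [A]. *)
Lemma card_path_components A (h : plane R -> R) (v : nat -> R) (r : nat) :
  {in A, continuous h} ->
  (forall y, A y -> exists2 i, (i < r)%N & h y = v i) ->
  (forall i, (i < r)%N -> exists2 y, A y & h y = v i) ->
  {in `I_r &, injective v} ->
  (forall y z, A y -> A z -> h y = h z -> segment y z `<=` A) ->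
  (path_components A #= `I_r)%card.
Proof.
move=> ch hv vh vI hA.
(* The component of [y] is its level set of [h]: along a path [h] takes finitely many values, so it
   agrees at both ends, and two points of one level are joined by a straight segment. *)
have joinE y : A y -> joined_in A y = [set z | A z /\ h z = h y].
  move=> Ay; apply/seteqP; split=> z.
    move=> [f [cf f0 f1 fA]]; split.
      by rewrite -f1; apply: fA; rewrite ler01 lexx.
    rewrite -f0 -f1; apply/esym.
    apply: (@finite_range_continuous_const (h \o f) (v @` `I_r)).
    - apply: within_continuous_comp cf => w; rewrite inE => -[s /= + <-].
      by rewrite in_itv/= => s01; apply/ch/mem_set/fA.
    - exact/finite_image/finite_II.
    - by move=> s s01; have [i ir hi] := hv _ (fA _ s01); exists i => //=.
  move=> [Az hzy]; exists (affine_path y z); split.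
  - exact/continuous_subspaceT/continuous_affine_path.
  - exact: affine_path0.
  - exact: affine_path1.
  - by move=> s s01; apply: (hA y z Ay Az) => //; exists s.
have -> : path_components A = (fun i => [set z | A z /\ h z = v i]) @` `I_r.
  apply/seteqP; split=> S.
    by move=> [y Ay <-]; have [i ir hi] := hv _ Ay; exists i; rewrite ?joinE ?hi.
  move=> [i ir <-]; have [y Ay hi] := vh _ ir.
  by exists y => //; rewrite joinE ?hi.
apply: inj_card_eq => i j; rewrite !inE => ir jr /= ij.
have [y Ay hy] := vh _ ir.
have [_ hy'] : [set z | A z /\ h z = v j] y by rewrite -ij.
by apply: vI; rewrite ?inE// -hy.
Qed.

Lemma edist_le x y s : 0 <= s ->
  (edist x y <= s) = ((x.1 - y.1) ^+ 2 + (x.2 - y.2) ^+ 2 <= s ^+ 2).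
Proof.
move=> s0; rewrite /edist -[LHS]ler_sqr ?nnegrE ?sqrtr_ge0// sqr_sqrtr//.
by rewrite addr_ge0 ?sqr_ge0.
Qed.

Lemma edist_ball_convex x y z s : edist x y <= s -> edist x z <= s ->
  segment y z `<=` [set w | edist x w <= s].
Proof.
move=> xy xz w [t /= /andP[t0 t1] <-].
have s0 : 0 <= s by apply: le_trans xy; exact: sqrtr_ge0.
move: xy xz; rewrite !edist_le// affine_pathE /= => xy xz.
set c := x.1 - y.1 in xy *; set d := x.2 - y.2 in xy *.
set c' := x.1 - z.1 in xz *; set d' := x.2 - z.2 in xz *.
have -> : x.1 - (y.1 + t * (z.1 - y.1)) = (1 - t) * c + t * c' by rewrite /c /c'; ring.
have -> : x.2 - (y.2 + t * (z.2 - y.2)) = (1 - t) * d + t * d' by rewrite /d /d'; ring.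
have t1' : 0 <= 1 - t by lra.
have := ler_wpM2l t0 xz; have := ler_wpM2l t1' xy.
(* The convexity defect of the square is [t * (1 - t) * (c - c') ^+ 2], and likewise for [d]. *)
have := mulr_ge0 (mulr_ge0 t0 t1') (sqr_ge0 (c - c')).
have := mulr_ge0 (mulr_ge0 t0 t1') (sqr_ge0 (d - d')).
nra.
Qed.

(** This is [i%:R *: u] plus the quarter turn of [u]. For [u] nonzero, all these vectors lie
    strictly on one side of the line along [u], and no two of them are parallel. *)
Definition fan_dir u (i : nat) : plane R :=
  (i%:R * u.1 - u.2, i%:R * u.2 + u.1).

Definition spoke x u e (i : nat) := segment x (x + e *: fan_dir u i).

(* The strings of [C] through [x] are one string crossing [x] and [k] strings
   starting at [x], on the same side of the former. *)
Definition fan (C : set (set (plane R))) (k : nat) x := exists a b t e,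
  [/\ a <> b, 0 < t < 1, 0 < e, x = affine_path a b t
    & forall l, C l /\ l x <->
        l = segment a b \/ exists2 i, (i < k)%N & l = spoke x (b - a) e i].

Lemma spokeP x u e i y : spoke x u e i y <-> exists2 s, 0 <= s <= 1 &
  y = (x.1 + s * e * (i%:R * u.1 - u.2), x.2 + s * e * (i%:R * u.2 + u.1)).
Proof.
split=> [[s s01 <-]|[s s01 ->]]; exists s => //; apply: planeP;
  by rewrite affine_pathE /= /GRing.scale /=; ring.
Qed.

Lemma cross_spoke x u e i s :
  cross u ((x.1 + s * e * (i%:R * u.1 - u.2), x.2 + s * e * (i%:R * u.2 + u.1)) - x)
  = s * e * dot u u.
Proof. by rewrite /cross /dot /=; ring. Qed.

Lemma dot_spoke x u e i s :
  dot u ((x.1 + s * e * (i%:R * u.1 - u.2), x.2 + s * e * (i%:R * u.2 + u.1)) - x)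
  = s * e * i%:R * dot u u.
Proof. by rewrite /dot /=; ring. Qed.

(** [u] and its quarter turn form an orthogonal basis, in which the two products are the coordinates
    of [y - x] up to the factor [dot u u]. *)
Lemma dot_cross0 u x y : u <> 0 -> dot u (y - x) = 0 -> cross u (y - x) = 0 ->
  y = x.
Proof.
move=> /dot_gt0 u0 d0 c0; have un0 : dot u u != 0 by rewrite gt_eqF.
apply: planeP; apply/eqP; rewrite -subr_eq0; apply/eqP; apply: (mulfI un0);
  move: d0 c0; rewrite /dot /cross /= mulr0 => d0 c0.
  have -> : (u.1 * u.1 + u.2 * u.2) * (y.1 - x.1) =
    u.1 * (u.1 * (y.1 - x.1) + u.2 * (y.2 - x.2)) -
    u.2 * (u.1 * (y.2 - x.2) - u.2 * (y.1 - x.1)) by ring.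
  by rewrite d0 c0; ring.
have -> : (u.1 * u.1 + u.2 * u.2) * (y.2 - x.2) =
  u.2 * (u.1 * (y.1 - x.1) + u.2 * (y.2 - x.2)) +
  u.1 * (u.1 * (y.2 - x.2) - u.2 * (y.1 - x.1)) by ring.
by rewrite d0 c0; ring.
Qed.

Lemma dot_affine_path u x y z s : dot u (affine_path y z s - x) =
  (1 - s) * dot u (y - x) + s * dot u (z - x).
Proof. by rewrite affine_pathE /dot /=; ring. Qed.

Lemma cross_affine_path u x y z s : cross u (affine_path y z s - x) =
  (1 - s) * cross u (y - x) + s * cross u (z - x).
Proof. by rewrite affine_pathE /cross /=; ring. Qed.

End Degree.

(** * The degree at the centre of a fan *)

Section FanDegree.
Context {R : realType}.
Implicit Types (x y z a b u : plane R) (s t e : R) (M : mesh R).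

(* In the coordinates along and across the crossing string, this function is
   constant on each ray and separates the rays of a fan. *)
Definition ray_slope u x y : R :=
  dot u (y - x) / (`|dot u (y - x)| + `|cross u (y - x)|).

(** Labels 0 and 1 are the two halves of the crossing string, with slopes 1 and -1. Label [j.+2] is
    spoke [j], where the dot product is [j] times the cross product. *)
Definition fan_slope (i : nat) : R :=
  if i is j.+2 then j%:R / (j%:R + 1) else (-1) ^+ i.

Lemma fan_slope_ge0 j : 0 <= (j%:R / (j%:R + 1) : R) < 1.
Proof.
have j0 : (0 : R) <= j%:R by exact: ler0n.
have j1 : (0 : R) < j%:R + 1 by lra.
by rewrite divr_ge0 ?(ltW j1)//= ltr_pdivrMr// mul1r ltrDl ltr01.
Qed.

(** The spokes have slopes in [0, 1), hence different from 1 and -1, and j / (j + 1) determines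
    j. *)
Lemma fan_slope_inj : injective fan_slope.
Proof.
have H i : fan_slope i.+2 <> fan_slope 0%N /\ fan_slope i.+2 <> fan_slope 1%N.
  by have := fan_slope_ge0 i; rewrite /= expr0 expr1; split; lra.
case=> [|[|i]] [|[|j]] //.
- by rewrite /= expr0 expr1 => ?; exfalso; lra.
- by move/esym => /(H j).1.
- by rewrite /= expr0 expr1 => ?; exfalso; lra.
- by move/esym => /(H j).2.
- by move/(H i).1.
- by move/(H i).2.
have i0 : (0 : R) <= i%:R by exact: ler0n.
have j0 : (0 : R) <= j%:R by exact: ler0n.
have i1 : (i%:R + 1 : R) != 0 by rewrite gt_eqF// ltr_wpDl.
have j1 : (j%:R + 1 : R) != 0 by rewrite gt_eqF// ltr_wpDl.
move=> /= /eqP; rewrite eqr_div// => /eqP ij.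
by congr _.+2; apply/eqP; rewrite -(@eqr_nat R); apply/eqP; lra.
Qed.

Lemma ray_slope_gt0 u x y : 0 < dot u (y - x) -> cross u (y - x) = 0 ->
  ray_slope u x y = fan_slope 0.
Proof.
move=> d0; rewrite /ray_slope => ->; rewrite normr0 addr0 gtr0_norm//.
by rewrite divff// gt_eqF.
Qed.

Lemma ray_slope_lt0 u x y : dot u (y - x) < 0 -> cross u (y - x) = 0 ->
  ray_slope u x y = fan_slope 1.
Proof.
move=> d0; rewrite /ray_slope => ->; rewrite normr0 addr0 ltr0_norm//.
by rewrite invrN mulrN divff// lt_eqF.
Qed.

Lemma ray_slope_spoke u x y s i : 0 < s -> dot u (y - x) = s * i%:R ->
  cross u (y - x) = s -> ray_slope u x y = fan_slope i.+2.
Proof.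
move=> s0; rewrite /ray_slope => -> ->; rewrite !ger0_norm ?mulr_ge0 ?(ltW s0)//=.
have i0 : (0 : R) <= i%:R by exact: ler0n.
by field; apply/andP; split; nra.
Qed.

(** The denominator vanishes only where both coordinates do, that is, at [x]. *)
Lemma continuous_ray_slope u x y : u <> 0 -> y <> x ->
  {for y, continuous (ray_slope u x)}.
Proof.
move=> u0 yx.
have cd : {for y, continuous (fun z => dot u (z - x))}.
  apply: cvgD; apply: cvgMr; apply: cvgB; try exact: cvg_cst;
    [exact: cvg_fst|exact: cvg_snd].
have cc := @continuous_cross R u x y.
apply: cvgM => //; apply: cvgV; last by apply: cvgD; exact: cvg_norm.
rewrite paddr_eq0// !normr_eq0; apply/negP => /andP[/eqP d0 /eqP c0].
by apply: yx; exact: dot_cross0 d0 c0.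
Qed.

Lemma edist_affine x y s : 0 <= s ->
  edist x (affine_path x y s) = s * edist x y.
Proof.
move=> s0; rewrite /edist -[in RHS](ger0_norm s0) -sqrtr_sqr -sqrtrM ?sqr_ge0//.
by congr Num.sqrt; rewrite affine_pathE /=; ring.
Qed.

(** The two halves of the crossing string and the [k] spokes are [k.+2] rays, told apart by
    [ray_slope]. As the star contains only strings through [x], every positive [rho] works. *)
Lemma fan_degree M k x : fan (strings M) k x -> has_degree M x k.+2.
Proof.
move=> [a [b [t [e [ab t01 e0 xE fanE]]]]].
apply: filterS (nbhs_right_gt 0) => rho rho0.
set u := b - a in fanE.
have u0 : u <> 0 by move=> /eqP; rewrite subr_eq0 => /eqP; exact/nesym.
have D0 := dot_gt0 u0.
set A := star M x rho `\ x.
have SA l y : strings M l -> l x -> l y -> edist x y <= rho -> y <> x -> A y.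
  by move=> *; split => //; exists l.
have dab s : dot u (affine_path a b s - x) = (s - t) * dot u u.
  by rewrite xE !affine_pathE /dot /u /=; ring.
have cab s : cross u (affine_path a b s - x) = 0.
  by rewrite xE !affine_pathE /cross /u /=; ring.
(* Where a point of the punctured star lies: on the crossing string, with no transverse coordinate,
   or on a spoke, strictly on its positive side. *)
have AP y : A y -> exists2 l, [/\ strings M l, l x & l y] &
  [/\ l = segment a b, cross u (y - x) = 0 & dot u (y - x) != 0] \/
  exists2 i, (i < k)%N & [/\ l = spoke x u e i, 0 < cross u (y - x)
    & dot u (y - x) = cross u (y - x) * i%:R].
  move=> [[l [Ml lx ly _]] yx]; exists l => //.
  have [lE|[i ik lE]] := (fanE l).1 (conj Ml lx).
    left; move: ly; rewrite lE => -[s s01 sE]; split => //.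
      by rewrite -sE cab.
    apply/eqP => d0; apply: yx; apply: (dot_cross0 u0 d0).
    by rewrite -sE cab.
  right; exists i => //; move: ly; rewrite lE => /spokeP[s s01 yE].
  rewrite yE cross_spoke dot_spoke; split=> //; last by ring.
  rewrite !mulr_gt0// lt_neqAle (andP s01).1 andbT; apply/eqP => s0.
  by apply: yx; apply: planeP; rewrite yE -s0 /= !mul0r addr0.
have nx y : cross u (y - x) != 0 \/ dot u (y - x) != 0 -> y <> x.
  by move=> + yx; rewrite yx subrr /cross /dot /= !mulr0 subrr addr0 eqxx; case.
apply: (@card_path_components _ _ (ray_slope u x) fan_slope).
- by move=> y /set_mem[_ yx]; exact: continuous_ray_slope.
- move=> y /AP[l _ [[_ c0 d0]|[i ik [_ c0 dE]]]].
    case: (ltrgt0P (dot u (y - x))) d0 => // d0 _.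
      by exists 0%N => //; exact: ray_slope_gt0.
    by exists 1%N => //; exact: ray_slope_lt0.
  by exists i.+2 => //; exact: ray_slope_spoke c0 dE erefl.
(* The factor [rho / (rho + edist x y)] is at most 1 and brings [y] within distance [rho] of [x]. *)
- have shrink y : exists2 s, 0 < s <= 1 & edist x (affine_path x y s) <= rho.
    have E0 : 0 <= edist x y by exact: sqrtr_ge0.
    exists (rho / (rho + edist x y)).
      by rewrite divr_gt0 ?ltr_wpDr//= ler_pdivrMr ?ltr_wpDr// mul1r lerDl.
    rewrite edist_affine; last by rewrite divr_ge0 ?addr_ge0// ltW.
    by rewrite mulrAC ler_pdivrMr ?ltr_wpDr// ler_wpM2l ?(ltW rho0)// lerDr ltW.
  have xx : dot u (x - x) = 0 by rewrite subrr /dot /= !mulr0 addr0.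
  have mx : segment a b x by exists t => //=; lra.
  have Mab : strings M (segment a b) by have [] := (fanE (segment a b)).2 (or_introl erefl).
  (* Pulling a point [c] of the crossing string towards [x] brings it into the star without changing
     its direction from [x]. *)
  have mother c : segment a b c -> dot u (c - x) != 0 -> cross u (c - x) = 0 ->
      exists2 y, A y & cross u (y - x) = 0 /\
        exists2 s, 0 < s & dot u (y - x) = s * dot u (c - x).
    move=> abc dc cc; have [s /andP[s0 s1] sr] := shrink c.
    have dy : dot u (affine_path x c s - x) = s * dot u (c - x).
      by rewrite dot_affine_path xx mulr0 add0r.
    exists (affine_path x c s).
      apply: (SA (segment a b)) => //.
        by apply: (segment_convex mx abc); exists s => //=; rewrite (ltW s0).
      by apply: nx; right; rewrite dy mulf_neq0// gt_eqF.
    split; last by exists s.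
    rewrite cross_affine_path cc mulr0 addr0.
    by rewrite subrr /cross /= !mulr0 subrr mulr0.
  case=> [|[|i]] ik.
  + have db : dot u (b - x) = (1 - t) * dot u u by rewrite -dab affine_path1.
    have db0 : 0 < dot u (b - x) by rewrite db mulr_gt0//; lra.
    have [||y Ay [cy [s s0 dy]]] := mother b (segmentr _ _).
    * by rewrite gt_eqF.
    * by have := cab 1; rewrite affine_path1.
    by exists y => //; rewrite ray_slope_gt0// dy mulr_gt0.
  + have da : dot u (a - x) = (0 - t) * dot u u by rewrite -dab affine_path0.
    have da0 : dot u (a - x) < 0 by rewrite da nmulr_rlt0//; lra.
    have [||y Ay [cy [s s0 dy]]] := mother a (segmentl _ _).
    * by rewrite lt_eqF.
    * by have := cab 0; rewrite affine_path0.
    by exists y => //; rewrite ray_slope_lt0// dy pmulr_rlt0.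
  + have [Mi xi] : strings M (spoke x u e i) /\ spoke x u e i x.
      by apply/(fanE _).2; right; exists i.
    set d := x + e *: fan_dir u i.
    have [s s01 sr] := shrink d; have [s0 s1] := andP s01.
    set y := affine_path x d s in sr.
    have yE : y = (x.1 + s * e * (i%:R * u.1 - u.2), x.2 + s * e * (i%:R * u.2 + u.1)).
      by apply: planeP; rewrite /y /d affine_pathE /= /GRing.scale /=; ring.
    have cy : cross u (y - x) = s * e * dot u u by rewrite yE cross_spoke.
    have dy : dot u (y - x) = s * e * dot u u * i%:R by rewrite yE dot_spoke; ring.
    have sD : 0 < s * e * dot u u by rewrite !mulr_gt0.
    exists y; last exact: ray_slope_spoke sD dy cy.
    apply: (SA (spoke x u e i)) => //; first by exists s => //=; rewrite (ltW s0).
    by apply: nx; left; rewrite cy gt_eqF.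
- by move=> i j _ _; exact: fan_slope_inj.
(* Equal slopes put [y] and [z] on the same ray. The segment between them stays in the disc and in
   the string by convexity, and misses [x] because a nonzero coordinate keeps its sign along it. *)
- move=> y z Ay Az hyz w yzw.
  have [[[_ [_ _ _ yr]] _] [[_ [_ _ _ zr]] _]] := (Ay, Az).
  have wr := edist_ball_convex yr zr yzw.
  have [s s01 wE] := yzw.
  have dw := dot_affine_path u x y z s.
  have cw := cross_affine_path u x y z s.
  rewrite wE /= in dw cw; move/andP: s01 => [s0 s1].
  have [l [Ml lx ly] ycase] := AP _ Ay; have [m [Mm mx mz] zcase] := AP _ Az.
  case: ycase => [[lE cy dy]|[i ik [lE cy dy]]];
    case: zcase => [[mE cz dz]|[j jk [mE cz dz]]].
  + move: ly mz; rewrite lE mE => ly mz.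
    apply: (SA (segment a b)) => //; try by rewrite -lE.
      exact: segment_convex yzw.
    apply: nx; right; rewrite dw.
    move: hyz; case: (ltrgt0P (dot u (y - x))) dy => // dy0 _;
      case: (ltrgt0P (dot u (z - x))) dz => // dz0 _.
    * by move=> _; rewrite gt_eqF//; nra.
    * by rewrite ray_slope_gt0// ray_slope_lt0// => /fan_slope_inj.
    * by rewrite ray_slope_lt0// ray_slope_gt0// => /fan_slope_inj.
    * by move=> _; rewrite lt_eqF//; nra.
  + move: hyz; rewrite (ray_slope_spoke cz dz erefl).
    by case: (ltrgt0P (dot u (y - x))) dy => // dy0 _;
      [rewrite ray_slope_gt0//|rewrite ray_slope_lt0//] => /fan_slope_inj.
  + move: hyz; rewrite (ray_slope_spoke cy dy erefl).
    by case: (ltrgt0P (dot u (z - x))) dz => // dz0 _;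
      [rewrite ray_slope_gt0//|rewrite ray_slope_lt0//] => /fan_slope_inj.
  + move: hyz; rewrite (ray_slope_spoke cy dy erefl) (ray_slope_spoke cz dz erefl).
    move=> /fan_slope_inj[ij]; move: ly mz; rewrite lE mE ij => ly mz.
    apply: (SA l) => //; first by rewrite lE ij; exact: segment_convex yzw.
    apply: nx; left; rewrite cw gt_eqF//; nra.
Qed.

End FanDegree.

(** * Finite configurations *)

Section Configurations.
Context {R : realType}.
Variables (cells : set (set (plane R))) (k : nat).
Hypothesis open_cells : forall U, cells U -> open U.
Hypothesis dense_cells : dense (\bigcup_(U in cells) U).
Implicit Types (x y z a b u p : plane R) (l m V : set (plane R)) (s t e : R).
Implicit Types C : set (set (plane R)).

Definition node_of C x := exists l m, [/\ C l, C m, l <> m, l x & m x].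

Record configuration C : Prop := Configuration {
  conf_finite : finite_set C;
  conf_segment : forall l, C l -> exists a b, a <> b /\ l = segment a b;
  conf_cell : forall l, C l -> exists2 U, cells U & l `<=` U;
  conf_collinear : forall l m, C l -> C m -> l <> m -> collinear l m ->
    l `&` m = set0;
  conf_fan : forall x, node_of C x -> fan C k x
}.

(* The nodes of [C] keep their degree in [C']. *)
Definition extends C C' :=
  C `<=` C' /\ forall x l, node_of C x -> C' l -> l x -> C l.

Lemma extends_refl C : extends C C.
Proof. by split. Qed.

Lemma node_of_sub C C' x : C `<=` C' -> node_of C x -> node_of C' x.
Proof. by move=> CC' [l [m [Cl Cm lm lx mx]]]; exists l, m; split => //; exact: CC'. Qed.

Lemma extends_trans C C' C'' : extends C C' -> extends C' C'' -> extends C C''.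
Proof.
move=> [s1 e1] [s2 e2]; split=> [l Cl|x l nx C''l lx]; first exact/s2/s1.
by apply: (e1 x l nx) => //; apply: (e2 x l) => //; exact: node_of_sub nx.
Qed.

Lemma fan_eq C C' x : (forall l, l x -> C l <-> C' l) -> fan C k x -> fan C' k x.
Proof.
move=> CC' [a [b [t [e [ab t01 e0 xE fanE]]]]]; exists a, b, t, e; split => // l.
by rewrite -fanE; split=> -[Cl lx]; split => //; apply/CC'.
Qed.

Lemma configuration0 : configuration set0.
Proof. by split=> // x [l [m []]]. Qed.

Lemma open_dense_conf C : finite_set C ->
  (forall l, C l -> exists a b, a <> b /\ l = segment a b) ->
  open (~` (\bigcup_(l in C) l)) /\ dense (~` (\bigcup_(l in C) l)).
Proof.
move=> finC sC; apply: open_dense_setC_bigcup => // l /sC[a [b [ab ->]]].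
  exact: closed_segment.
exact: dense_setC_segment.
Qed.

(** A short segment is placed in [V], inside one cell and off all strings of [C]. It creates no
    node, so all fans are unchanged. *)
Lemma add_string C V : configuration C -> open V -> V !=set0 ->
  exists C', [/\ configuration C', extends C C' & exists2 l, C' l & l `<=` V].
Proof.
move=> conf oV V0; have [finC segC cellC colC fanC] := conf.
have [oO dO] := open_dense_conf finC segC.
have [x [Vx [U cU Ux]]] := dense_cells V0 oV.
have [y [[Vy Uy] Oy]] : (V `&` U) `&` ~` (\bigcup_(l in C) l) !=set0.
  by apply: dO; [exists x|apply: openI => //; exact: open_cells].
have [e e0 eW] : exists2 e : R, 0 < e & forall z, `|y.1 - z.1| < e ->
    `|y.2 - z.2| < e -> ((V `&` U) `&` ~` (\bigcup_(l in C) l)) z.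
  apply: plane_open_box => //; apply: openI => //.
  by apply: openI => //; exact: open_cells.
(* A horizontal segment: only the first coordinate varies, by at most [e / 2], so it stays in the
   box. *)
pose l0 := segment y (y + (e / 2, 0)).
have l0W : l0 `<=` (V `&` U) `&` ~` (\bigcup_(l in C) l).
  move=> z [t /= /andP[t0 t1] <-]; apply: eW; rewrite affine_pathE /=.
    by rewrite ltr_norml; apply/andP; split; nra.
  by rewrite addr0 !subrr mulr0 addr0 subrr normr0.
have l0C l z : C l -> l z -> l0 z -> False.
  by move=> Cl lz /l0W[_]; apply; exists l.
have l0y : l0 y by exact: segmentl.
exists (C `|` [set l0]); split; last first.
- by exists l0; [right|move=> z /l0W[[]]].
- split=> [l Cl|z l [m [_ [Cm _ _ mz _]]]]; first by left.
  by case=> // -> l0z; case: (l0C m z).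
split.
- by rewrite finite_setU; split => //; exact: finite_set1.
- move=> l [|->]; first exact: segC.
  exists y, (y + (e / 2, 0)); split => // /(congr1 fst) /=; lra.
- move=> l [|->]; first exact: cellC.
  by exists U => // z /l0W[[]].
- move=> l m [Cl|->] [Cm|->] lm cl //; first exact: colC.
  + by apply/eqP/negPn/negP => /set0P[z [lz mz]]; exact: l0C Cl lz mz.
  + by apply/eqP/negPn/negP => /set0P[z [lz mz]]; exact: l0C Cm mz lz.
move=> z [l [m [Cl Cm lm lz mz]]].
have [l0z|nl0z] := pselect (l0 z).
  case: Cl lm lz => [Cl|->] lm lz; first by case: (l0C l z).
  by case: Cm lm mz => [Cm|->] // lm mz; case: (l0C m z).
apply: (@fan_eq C) => [n nz|]; first by split=> [|[|nE]]; [left| |rewrite nE in nz].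
apply: fanC; exists l, m; split => //.
  by case: Cl lz => [//|->].
by case: Cm mz => [//|->].
Qed.

Lemma spoke_small x u V : open V -> V x ->
  exists2 e, 0 < e & forall i, (i < k)%N -> spoke x u e i `<=` V.
Proof.
move=> oV Vx; have [d d0 dV] := plane_open_box oV Vx.
(* [c] exceeds both coordinates of [fan_dir u i] in absolute value for all [i < k], and the summand
   1 keeps it positive. Length factor [d / c] thus fits every spoke into the box. *)
pose c := k%:R * `|u.1| + k%:R * `|u.2| + `|u.1| + `|u.2| + 1.
have k0 : (0 : R) <= k%:R by exact: ler0n.
have [n1 n2] : 0 <= `|u.1| /\ 0 <= `|u.2| by [].
have c0 : 0 < c by have := mulr_ge0 k0 n1; have := mulr_ge0 k0 n2; rewrite /c; lra.
exists (d / c) => [|i ik z /spokeP[s /andP[s0 s1] ->]]; first exact: divr_gt0.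
have ik' : (i%:R : R) <= k%:R by rewrite ler_nat ltnW.
have i0 : (0 : R) <= i%:R by exact: ler0n.
have small (w : R) : `|w| < c -> `|s * (d / c) * w| < d.
  move=> wc; rewrite 2!normrM (ger0_norm s0) (ger0_norm (ltW (divr_gt0 d0 c0))).
  rewrite (@le_lt_trans _ _ (d / c * `|w|))//.
    by rewrite ler_wpM2r// ler_piMl// ltW// divr_gt0.
  by rewrite mulrAC ltr_pdivrMr// ltr_pM2l.
have b1 := ler_wpM2r n1 ik'; have b2 := ler_wpM2r n2 ik'.
apply: dV => /=; rewrite opprD addNKr normrN; apply: small.
  rewrite (le_lt_trans (ler_normB _ _))// normrM (ger0_norm i0) /c.
  by have := mulr_ge0 k0 n2; lra.
rewrite (le_lt_trans (ler_normD _ _))// normrM (ger0_norm i0) /c.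
by have := mulr_ge0 k0 n1; lra.
Qed.


(** The given point may be an endpoint; moving its parameter slightly towards the midpoint makes it
    interior. *)
Lemma affine_path_open a b V : open V -> (segment a b `&` V) !=set0 ->
  exists2 t : R, 0 < t < 1 & V (affine_path a b t).
Proof.
move=> oV [_ [[t t01 <-] Vy]].
have oT : open (affine_path a b @^-1` V).
  by move/continuousP: (@continuous_affine_path R a b); exact.
have /nbhs_ballP[e /= e0 eT] : nbhs t (affine_path a b @^-1` V).
  exact: open_nbhs_nbhs.
move: t01 => /= /andP[t0 t1].
(* This proportion is smaller than both 1 and [e]. *)
pose d := e / (1 + e).
have e1 : 0 < 1 + e by lra.
have d0 : 0 < d by exact: divr_gt0.
have d1 : d < 1 by rewrite /d ltr_pdivrMr//; lra.
have de : d < e by rewrite /d ltr_pdivrMr//; nra.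
exists (t + d * (2^-1 - t)); first by apply/andP; split; nra.
apply: eT; rewrite /ball /= opprD addNKr normrN ltr_norml.
by apply/andP; split; nra.
Qed.

(** Every other string meets [l] at most once, since collinear strings are disjoint. Only finitely
    many parameters are therefore forbidden, and their complement is dense. *)
Lemma conf_fresh_point C l a b V : configuration C -> C l -> a <> b ->
  l = segment a b -> open V -> l `&` V !=set0 ->
  exists t, [/\ 0 < t < 1, V (affine_path a b t) &
    forall m, C m -> m (affine_path a b t) -> m = l].
Proof.
move=> [finC segC cellC colC fanC] Cl ab lE oV lV.
pose F m : set R := [set t | 0 <= t <= 1 /\ m (affine_path a b t)].
have finF : finite_set (\bigcup_(m in C `\ l) F m).
  apply: bigcup_finite => [|m [Cm /= ml]]; first exact: finite_setD.
  have [->|/set0P[t [t01 mt]]] := eqVneq (F m) set0; first exact: finite_set0.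
  apply: (sub_finite_set _ (finite_set1 t)) => s [s01 ms] /=.
  have [c [d [_ mE]]] := segC _ Cm.
  have lt : l (affine_path a b t) by rewrite lE; exists t.
  have ls : l (affine_path a b s) by rewrite lE; exists s.
  apply: (affine_path_inj ab); apply: (@meet_not_collinear _ a b c d);
    rewrite -?lE -?mE// => cl.
  by have : (l `&` m) (affine_path a b t) by []; rewrite colC//; exact/nesym.
have [t0 t001 Vt0] : exists2 t, 0 < t < 1 & V (affine_path a b t).
  by apply: affine_path_open; rewrite -?lE.
have [||t [[/= t01 Vt] nF]] := finite_setC_dense finF
    (O := `]0, 1[%classic `&` affine_path a b @^-1` V).
- by exists t0; split => //=; rewrite in_itv.
- apply: openI; first exact: itv_open.
  by move/continuousP: (@continuous_affine_path R a b); exact.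
move: t01; rewrite in_itv /= => t01.
exists t; split => // m Cm mt; apply: contrapT => ml; apply: nF.
by exists m => //; split => //; case/andP: t01 => *; rewrite !ltW.
Qed.

(** At a fresh point [p] of [l], [k] spokes are attached, short enough to stay in the cell of [l]
    and to avoid all other strings. They meet the old strings and one another only at [p], so [p] is
    the only new node and no old node gains a string. *)
Lemma add_node C l V : (0 < k)%N -> configuration C -> C l -> open V ->
  l `&` V !=set0 ->
  exists C', [/\ configuration C', extends C C'
    & exists x, [/\ l x, V x & node_of C' x]].
Proof.
move=> k0 conf Cl oV lV; have [finC segC cellC colC fanC] := conf.
have [a [b [ab lE]]] := segC _ Cl.
have [t [t01 Vp pl]] := conf_fresh_point conf Cl ab lE oV lV.
set p := affine_path a b t in Vp pl; pose u := b - a.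
have [U cU lU] := cellC _ Cl.
have lp : l p by rewrite lE; exists t => //=; case/andP: t01 => *; rewrite !ltW.
have u0 : u <> 0 by move=> /eqP; rewrite subr_eq0 => /eqP; exact/nesym.
have D0 := dot_gt0 u0.
have [e e0 eW] : exists2 e, 0 < e & forall i, (i < k)%N ->
    spoke p u e i `<=` U `&` ~` (\bigcup_(m in C `\ l) m).
  apply: spoke_small; last by split; [exact: lU|case=> m [Cm /= ml] /(pl _ Cm)].
  apply: openI; first exact: open_cells.
  apply: (open_dense_conf _ _).1; first exact: finite_setD.
  by move=> m [/segC].
pose c i := spoke p u e i.
have cp i : c i p by exact: segmentl.
have c_end i : c i (p + e *: fan_dir u i) by exact: segmentr.
(* The only old string a spoke can meet is [l], and its cross product with [u] vanishes only at
   [p]. *)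
have cC m i y : (i < k)%N -> C m -> m y -> c i y -> m = l /\ y = p.
  move=> ik Cm my ciy.
  have ml : m = l.
    by apply: contrapT => ml; have [_] := eW _ ik _ ciy; apply; exists m.
  split=> //; move: my; rewrite ml lE => /segment_cross.
  move: ciy => /spokeP[s s01 ->]; set z := (X in cross _ (X - _)) => cz.
  have : cross u (z - p) = 0.
    have -> : cross u (z - p) = cross u (z - a) - cross u (p - a).
      by rewrite /cross /=; ring.
    by rewrite cz (@segment_cross _ a b p) ?subrr// -lE.
  rewrite cross_spoke => /eqP; rewrite !mulf_eq0 (gt_eqF e0) (gt_eqF D0) !orbF.
  by move=> /eqP s0; apply: planeP; rewrite /z s0 /= !mul0r addr0.
(* Equal cross products force equal parameters; the dot products then differ unless the parameter is
   0. *)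
have cc i j y : c i y -> c j y -> i <> j -> y = p.
  move=> /spokeP[s s01 yi] /spokeP[r r01 yj] ij.
  have := cross_spoke p u e i s; have := dot_spoke p u e i s.
  rewrite -yi yj dot_spoke cross_spoke => /(mulIf (lt0r_neq0 D0)) dE.
  move=> /(mulIf (lt0r_neq0 D0))/(mulIf (lt0r_neq0 e0)) rs.
  have : s * (i%:R - j%:R) = 0.
    by apply: (mulfI (lt0r_neq0 e0)); move: dE; rewrite rs; lra.
  move=> /eqP; rewrite mulf_eq0 subr_eq0 eqr_nat => /orP[/eqP s0|/eqP//].
  by rewrite rs s0; apply: planeP; rewrite /= !mul0r addr0.
have lc i : ~ collinear l (c i).
  apply: (@not_collinear_cross _ _ _ p b (p + e *: fan_dir u i)) => //.
    by rewrite lE; exact: segmentr.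
  have -> : cross (b - p) (p + e *: fan_dir u i - p) = (1 - t) * e * dot u u.
    by rewrite /p affine_pathE /cross /dot /u /fan_dir /= /GRing.scale /=; ring.
  by rewrite gt_eqF// !mulr_gt0//; lra.
have ncc i j : i <> j -> ~ collinear (c i) (c j).
  move=> ij; apply: (@not_collinear_cross _ _ _ p (p + e *: fan_dir u i)
    (p + e *: fan_dir u j)) => //.
  have -> : cross (p + e *: fan_dir u i - p) (p + e *: fan_dir u j - p) =
      e * e * (i%:R - j%:R) * dot u u.
    by rewrite /cross /dot /fan_dir /= /GRing.scale /=; ring.
  have ij0 : (i%:R - j%:R : R) != 0 by rewrite subr_eq0 eqr_nat; exact/eqP.
  by rewrite !mulf_neq0// lt0r_neq0.
have collinearC (m n : set (plane R)) : collinear m n -> collinear n m.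
  by move=> [x [y [xy ml nl]]]; exists x, y.
pose C' := C `|` [set c i | i in `I_k].
have C'p m : C' m -> m p -> m = l \/ exists2 i, (i < k)%N & m = c i.
  by move=> [Cm mp|[i ik <-] _]; [left; exact: pl|right; exists i].
have nodeC' y : node_of C' y -> node_of C y \/ y = p.
  move=> [m [n [[Cm|[i ik <-]] [Cn|[j jk <-]] mn my ny]]].
  - by left; exists m, n.
  - by right; have [] := cC _ _ _ jk Cm my ny.
  - by right; have [] := cC _ _ _ ik Cn ny my.
  - by right; apply: (cc i j) => // ij; apply: mn; rewrite ij.
have nCp : ~ node_of C p.
  by move=> [m [n [Cm Cn mn mp np]]]; apply: mn; rewrite (pl m)// (pl n).
have ext y m : y <> p -> node_of C y -> C' m -> m y -> C m.
  move=> yp [n [_ [Cn _ _ ny _]]] [//|[i ik <-]] cy.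
  by case: yp; have [] := cC _ _ _ ik Cn ny cy.
exists C'; split; last first.
- exists p; split => //; exists l, (c 0%N); split => //.
  + by left.
  + by right; exists 0%N.
  + move=> lc0; apply: (lc 0%N); rewrite -lc0; exists a, b; split => //;
      by rewrite lE => _ [s _ <-]; exists s.
- split=> [m Cm|y m ny]; first by left.
  by apply: ext => // yp; apply: nCp; rewrite -yp.
split.
- by rewrite finite_setU; split => //; apply/finite_image/finite_II.
- move=> m [/segC//|[i ik <-]]; exists p, (p + e *: fan_dir u i); split => //.
  (* A degenerate spoke would reduce to the point [p] of [l], and so be collinear with [l]. *)
  move=> pE; apply: (lc i); exists a, b; split => //.
    by rewrite lE => _ [s _ <-]; exists s.
  rewrite /c /spoke -pE => _ [s _ <-]; exists t => //.
  by rewrite -/p [RHS]/affine_path subrr scaler0 addr0.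
- move=> m [/cellC//|[i ik <-]]; exists U => // y ciy.
  by have [] := eW _ ik _ ciy.
(* A spoke is collinear neither with [l] nor with another spoke, and it is disjoint from the
   remaining strings. *)
- move=> m n [Cm|[i ik <-]] [Cn|[j jk <-]] mn cl.
  + exact: colC.
  + apply/eqP/negPn/negP => /set0P[y [my ny]].
    by have [ml _] := cC _ _ _ jk Cm my ny; apply: (lc j); rewrite -ml.
  + apply/eqP/negPn/negP => /set0P[y [my ny]].
    have [nl _] := cC _ _ _ ik Cn ny my; apply: (lc i); rewrite -nl.
    exact: collinearC.
  + have ij : i <> j by move=> ij; apply: mn; rewrite ij.
    by case: (ncc i j ij).
move=> y /nodeC'[ny|->].
  apply: (@fan_eq C) (fanC _ ny) => m my; split; first by left.
  by move=> C'm; apply: ext my => // yp; apply: nCp; rewrite -yp.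
exists a, b, t, e; split => // m; split=> [[C'm mp]|].
  by have [->|[i ik ->]] := C'p _ C'm mp; [left|right; exists i].
case=> [->|[i ik ->]]; first by rewrite -lE; split => //; left.
by split; [right; exists i|exact: (cp i)].
Qed.

End Configurations.

(** * The mesh *)

(** The 2-adic valuation takes each value [i] at all the numbers 2^i 3^m. This schedule visits every
    basic open set again after any given stage. *)
Lemma nat_seq_inf_often : exists e : nat -> nat,
  forall i m, exists2 n, (m <= n)%N & e n = i.
Proof.
exists (logn 2) => i m; exists (2 ^ i * 3 ^ m)%N.
  by rewrite (leq_trans (ltnW (ltn_expl m _ : m < 3 ^ m)%N))// leq_pmull// expn_gt0.
by rewrite lognM ?expn_gt0// pfactorK// lognX muln0 addn0.
Qed.

Lemma subsingleton_countable (T : Type) (A : set T) :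
  (forall x y, A x -> A y -> x = y) -> countable A.
Proof.
move=> hA; apply: finite_set_countable.
have [->|/set0P[x Ax]] := eqVneq A set0; first exact: finite_set0.
by apply: (sub_finite_set _ (finite_set1 x)) => y Ay; exact: hA.
Qed.

Section CellMesh.
Context {R : realType}.
Variables (cells : set (set (plane R))) (k : nat).
Hypothesis open_cells : forall U, cells U -> open U.
Hypothesis dense_cells : dense (\bigcup_(U in cells) U).
Hypothesis k_gt0 : (0 < k)%N.
Implicit Types (x y z a b u p : plane R) (l V : set (plane R)).
Implicit Types C : set (set (plane R)).

Local Notation configuration := (configuration cells k).

Lemma add_nodes C V (s : seq (set (plane R))) : configuration C -> open V ->
  [set` s] `<=` C -> exists C', [/\ configuration C', extends C C'
    & forall l, l \in s -> l `&` V !=set0 ->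
        exists x, [/\ l x, V x & node_of C' x]].
Proof.
move=> + oV; elim: s C => [|l s IH] C conf sC.
  by exists C; split => //; exact: extends_refl.
have Cl : C l by apply: sC; exact: mem_head.
have sC' : [set` s] `<=` C by move=> m ms; apply: sC; rewrite /= inE ms orbT.
have [C1 [conf1 ext1 node1]] : exists C1, [/\ configuration C1, extends C C1
    & l `&` V !=set0 -> exists x, [/\ l x, V x & node_of C1 x]].
  have [lV|lV] := pselect (l `&` V !=set0).
    have [C1 [conf1 ext1 node1]] := add_node open_cells k_gt0 conf Cl oV lV.
    by exists C1; split.
  by exists C; split => //; exact: extends_refl.
have [C2 [conf2 ext2 node2]] := IH C1 conf1 (subset_trans sC' ext1.1).
exists C2; split => //; first exact: extends_trans ext2.
move=> m; rewrite inE => /orP[/eqP ->|ms] mV; last exact: node2.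
have [x [lx Vx nx]] := node1 mV; exists x; split => //.
exact: node_of_sub ext2.1 nx.
Qed.

(** Nodes in [V] are demanded only on the strings of [C]; strings added meanwhile are served at a
    later visit to the same set. *)
Definition visits V C C' := [/\ extends C C',
  V !=set0 -> exists2 l, C' l & l `<=` V
  & forall l, C l -> l `&` V !=set0 -> exists x, [/\ l x, V x & node_of C' x]].

Lemma visits_exists V C : open V -> configuration C ->
  exists C', configuration C' /\ visits V C C'.
Proof.
move=> oV conf; have /finite_seqP[s sE] := conf_finite conf.
have [|C1 [conf1 ext1 node1]] := @add_nodes C V s conf oV; first by rewrite sE.
have node1' l : C l -> l `&` V !=set0 -> exists x, [/\ l x, V x & node_of C1 x].
  by move=> Cl; apply: node1; move: Cl; rewrite sE.
have [V0|V0] := pselect (V !=set0); last by exists C1; split => //; split.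
have [C2 [conf2 ext2 str2]] := add_string open_cells dense_cells conf1 oV V0.
exists C2; split => //; split => //; first exact: extends_trans ext2.
move=> l Cl lV; have [x [lx Vx nx]] := node1' l Cl lV; exists x; split => //.
exact: node_of_sub ext2.1 nx.
Qed.

Lemma configuration_chain : exists C : nat -> set (set (plane R)),
  [/\ forall n, configuration (C n), forall n m, (n <= m)%N -> extends (C n) (C m),
    forall V, open V -> V !=set0 -> exists n, exists2 l, C n l & l `<=` V
  & forall n l x V, C n l -> l x -> open V -> V x ->
      exists m y, [/\ l y, V y & node_of (C m) y]].
Proof.
have [B [oB baseB]] := @plane_countable_base R.
have [e he] := nat_seq_inf_often.
have [F hF] : exists F : nat -> set (set (plane R)) -> set (set (plane R)),
    forall n C, configuration C ->
      configuration (F n C) /\ visits (B (e n)) C (F n C).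
  (* The implication makes the relation total, so that [choice] applies; [set0] is a dummy value
     outside configurations. *)
  have H nC : exists C', configuration nC.2 ->
      configuration C' /\ visits (B (e nC.1)) nC.2 C'.
    have [conf|nconf] := pselect (configuration nC.2); last by exists set0.
    have [C' C'P] := visits_exists (oB (e nC.1)) conf.
    by exists C'.
  have [F hF] := choice H.
  by exists (fun n C => F (n, C)) => n C; exact: (hF (n, C)).
pose C := fix C n := if n is m.+1 then F m (C m) else set0.
have confC n : configuration (C n).
  by elim: n => [|n IH]; [exact: configuration0|case: (hF n _ IH)].
have visC n : visits (B (e n)) (C n) (C n.+1) by have [] := hF n _ (confC n).
have extC n m : (n <= m)%N -> extends (C n) (C m).
  move=> /subnK <-; elim: (m - n)%N => [|d IH]; first exact: extends_refl.
  by rewrite addSn; have [ext _ _] := visC (d + n)%N; exact: extends_trans ext.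
exists C; split => //.
  move=> V oV [x Vx]; have [i Bx BV] := baseB _ _ oV Vx.
  have [n _ ni] := he i 0%N; have [_ str _] := visC n.
  have [|l Cl lB] := str; first by exists x; rewrite ni.
  by exists n.+1, l => //; apply: subset_trans BV; rewrite -ni.
move=> n l x V Cl lx oV Vx; have [i Bx BV] := baseB _ _ oV Vx.
(* The basic set around [x] is visited at some stage [m] not before [n], when [l] is already
   present. *)
have [m nm mi] := he i n; have [_ _ vis] := visC m.
have [||y [ly By ny]] := vis l; first exact: (extC _ _ nm).1.
  by exists x; split => //; rewrite mi.
by exists m.+1, y; split => //; apply: BV; rewrite -mi.
Qed.

(** The strings are the union of the chain. Any two of them occur at a common finite stage, which
    supplies the pairwise properties; density comes from the visits. *)
Lemma cell_mesh : exists M : mesh R,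
  [/\ dense_mesh M, forall x, nodes M x -> has_degree M x k.+2
    & forall l, strings M l ->
        (exists a b, l = segment a b) /\ exists2 U, cells U & l `<=` U].
Proof.
have [C [confC extC strC nodeC]] := configuration_chain.
pose S := \bigcup_n C n.
have common l m : S l -> S m -> exists2 n, C n l & C n m.
  move=> [i _ Cl] [j _ Cm]; exists (maxn i j).
    exact: ((extC _ _ (leq_maxl i j)).1 _ Cl).
  exact: ((extC _ _ (leq_maxr i j)).1 _ Cm).
have nodeS x l V : S l -> l x -> open V -> V x ->
    exists y, [/\ l y, V y & node_of S y].
  move=> [n _ Cl] lx oV Vx; have [m [y [ly Vy ny]]] := nodeC n l x V Cl lx oV Vx.
  exists y; split => //; apply: node_of_sub ny => h Ch; by exists m.
have segS l : S l -> exists a b, a <> b /\ l = segment a b.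
  by move=> [n _ Cl]; exact: conf_segment Cl.
have colS l m : S l -> S m -> l <> m -> collinear l m -> l `&` m = set0.
  by move=> Sl Sm; have [n] := common _ _ Sl Sm; exact: (conf_collinear (confC n)).
have S0 : S !=set0.
  have [n [l Cl _]] : exists n, exists2 l, C n l & l `<=` setT.
    by apply: strC; [exact: openT|exists 0].
  by exists l, n.
have Sc : countable S.
  apply: bigcup_countable => // n _; exact/finite_set_countable/(conf_finite (confC n)).
have node0 : node_of S !=set0.
  have [l Sl] := S0; have [a [b [_ lE]]] := segS _ Sl.
  have [||y [_ _ ny]] := nodeS a l setT Sl _ openT; rewrite ?lE//.
    exact: segmentl.
  by exists y.
have nodec : countable (node_of S).
  (* Two distinct strings share at most one point, so the nodes are covered by countably many sets
     of at most one point. *)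
  have : countable (\bigcup_(l in S) \bigcup_(m in S `\ l) (l `&` m)).
    apply: bigcup_countable => // l Sl.
    apply: bigcup_countable => [|m [Sm /= ml]].
      exact: sub_countable (subset_card_le (@subDsetl _ _ _)) Sc.
    apply: subsingleton_countable => x y [lx mx] [ly my].
    have [a [b [_ lE]]] := segS _ Sl; have [c [d [_ mE]]] := segS _ Sm.
    apply: (@meet_not_collinear _ a b c d); rewrite -?lE -?mE// => cl.
    by have : (l `&` m) x by []; rewrite colS//; exact/nesym.
  apply: sub_countable; apply: subset_card_le => x [l [m [Sl Sm lm lx mx]]].
  by exists l => //; exists m => //; split => // /esym.
have dn l : S l -> l `<=` closure (l `&` node_of S).
  move=> Sl x lx V; rewrite nbhsE => -[W [oW Wx] WV].
  by have [y [ly Wy ny]] := nodeS x l W Sl lx oW Wx; exists y; split => //; exact: WV.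
have strS l : S l -> string l.
  by move=> /segS[a [b [ab ->]]]; exists a, b; split => //; exact: Or32.
exists (@Mesh R (node_of S) S S0 Sc strS colS erefl node0 nodec dn).
split.
- move=> V V0 oV; have [n [l Cl lV]] := strC V oV V0.
  have Sl : S l by exists n.
  have [a [b [_ lE]]] := segS _ Sl.
  have la : l a by rewrite lE; exact: segmentl.
  by have [y [ly Vy ny]] := nodeS a l V Sl la oV (lV _ la); exists y.
(* The fan at a node of stage [n] is final: by [extends], every later string through that node
   already belongs to [C n]. *)
- move=> x [l [m [Sl Sm lm lx mx]]]; apply: fan_degree => /=.
  have [n Cl Cm] := common _ _ Sl Sm.
  have nx : node_of (C n) x by exists l, m.
  apply: (@fan_eq _ k (C n)) (conf_fan (confC n) nx) => h hx.
  split=> [Ch|[i _ Ch]]; first by exists n.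
  have [i' n'] := (leq_maxl n i, leq_maxr n i).
  apply: ((extC _ _ i').2 x h nx _ hx); exact: (extC _ _ n').1.
move=> l Sl; split; first by have [a [b [_ ->]]] := segS _ Sl; exists a, b.
by case: Sl => n _; exact: conf_cell.
Qed.

End CellMesh.

(** * The staircase *)

Section Staircase.
Context {R : realType}.
Implicit Types (s t : R).

Local Notation mu := (@lebesgue_measure R).

Lemma small_open_rat (e : R) : 0 < e -> exists Q : set R,
  [/\ measurable Q, (mu Q <= e%:E)%E
    & forall q : rat, exists2 d, 0 < d & ball (ratr q : R) d `<=` Q].
Proof.
move=> e0.
(* A ball has measure twice its radius, so the measures are [e] / 2^(n+1), with total at most
   [e]. *)
pose d n : R := e / 2 / (2 ^ n.+1)%:R.
(* Below, an index that encodes no rational gets a ball around 0, which is covered by the same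
   measure bound. *)
have d0 n : 0 < d n by rewrite !divr_gt0// ltr0n expn_gt0.
pose B n : set R := ball (ratr (odflt 0 (unpickle n : option rat)) : R) (d n).
have mB n : measurable (B n) by exact: measurable_realfun.measurable_ball.
exists (\bigcup_n B n); split.
- exact: bigcupT_measurable.
- apply: (@le_trans _ _ (\sum_(0 <= n <oo) mu (B n))%E).
    by apply: measure_sigma_subadditive => //; exact: bigcupT_measurable.
  apply: le_trans (epsilon_trick0 xpredT (ltW e0)).
  apply: lee_nneseries => [n _ _|n _]; first exact: measure_ge0.
  rewrite lebesgue_measure_ball ?(ltW (d0 n))// lee_fin /d.
  have N0 : ((2 ^ n.+1)%:R : R) != 0 by rewrite pnatr_eq0 -lt0n expn_gt0.
  by rewrite le_eqVlt; apply/orP; left; apply/eqP; field.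
move=> q; exists (d (pickle q)) => // x qx; exists (pickle q) => //.
by rewrite /B pickleK.
Qed.

(* The staircase measures the part of [s, 2) outside a small neighbourhood of
   the rationals. *)
Lemma staircase : exists c : R -> R,
  [/\ continuous c, forall s, 2 <= s -> c s = 0, 0 < c 1 <= 1
    & forall q : rat, exists2 d, 0 < d &
        forall s t, ball (ratr q : R) d s -> ball (ratr q : R) d t -> c s = c t].
Proof.
(* A neighbourhood of measure at most 1/2 leaves at least 1/2 of the interval [1, 2). *)
have h0 : (0 : R) < 2^-1 by rewrite invr_gt0.
have [Q [mQ Qle Qq]] := small_open_rat h0.
pose A s : set R := `[s, 2[ `\` Q.
have mA s : measurable (A s) by exact: measurableD.
have mu_co s t : s <= t -> mu `[s, t[ = (t - s)%:E.
  move=> st; rewrite lebesgue_measure_itv/= lte_fin.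
  by move: st; rewrite le_eqVlt => /orP[/eqP ->|->]; rewrite ?ltxx ?subrr -?EFinB.
have mu_le (X Y : set R) : measurable X -> measurable Y -> X `<=` Y ->
    (mu X <= mu Y)%E.
  by move=> mX mY XY; apply: (le_measure mu) => //; rewrite inE.
have Afin s : (mu (A s) \is a fin_num).
  have [s2|s2] := leP s 2.
    rewrite ge0_fin_numE; last exact: measure_ge0.
    apply: (@le_lt_trans _ _ (mu `[s, 2[)); last by rewrite mu_co// ltry.
    by apply: mu_le => //; exact: subDsetl.
  have -> : A s = set0.
    by apply/seteqP; split => // x [/=]; rewrite in_itv /=; lra.
  by rewrite measure0.
(* The staircase is nonincreasing and 1-Lipschitz, which gives continuity. *)
have Ale s t : s <= t -> fine (mu (A t)) <= fine (mu (A s)) <= fine (mu (A t)) + (t - s).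
  move=> st; apply/andP; split.
    apply: fine_le => //; apply: mu_le => //.
    by apply: setSD => x /=; rewrite !in_itv/= => /andP[tx ->]; rewrite (le_trans st).
  rewrite -[X in _ + X]/(fine (t - s)%:E) -fineD//.
  apply: fine_le; rewrite ?fin_numD ?Afin//.
  rewrite -mu_co//; apply: (le_trans _ (measureU2 mu (mA t) _)) => //.
  apply: mu_le => //; first exact: measurableU.
  move=> x [/=]; rewrite !in_itv/= => /andP[sx x2] nO.
  have [tx|xt] := leP t x; first by left; split => //=; rewrite in_itv/= tx.
  by right; rewrite sx.
exists (fun s => fine (mu (A s))); split.
- move=> s; apply/cvgrPdist_lt => e e0; apply/nbhs_ballP; exists e => //= t st.
  apply: le_lt_trans st; have := ler_norm (s - t); have := ler_norm (t - s).
  rewrite (distrC t s) ler_norml => ts st.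
  by have [/Ale|/ltW/Ale] := leP s t => /andP[*]; apply/andP; split; lra.
- move=> s s2; have -> : A s = set0; last by rewrite measure0.
  by apply/seteqP; split => // x [/=]; rewrite in_itv /=; lra.
- have : (mu `[1%R, 2%R[ <= mu (A 1%R) + mu Q)%E.
    apply: (le_trans _ (measureU2 mu (mA 1) mQ)) => //.
    apply: mu_le => //; first exact: measurableU.
    by move=> x x12; have [Ox|nO] := pselect (Q x); [right|left].
  move=> H; have {}H := le_trans H (leeD2l _ Qle); apply/andP; split.
    move: H; rewrite mu_co; last lra.
    by rewrite -(fineK (Afin 1)) -EFinD lee_fin; lra.
  rewrite -lee_fin fineK// (@le_trans _ _ (mu `[1, 2[))//.
    by apply: mu_le => //; exact: subDsetl.
  by rewrite mu_co ?lee_fin; lra.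
(* Points between [s] and [t] lie in [Q], so removing [Q] makes [A s] and [A t] equal. *)
move=> q; have [d d0 dO] := Qq q; exists d => // s t.
wlog st : s t / s <= t.
  by move=> W; have [st|/ltW ts] := leP s t; [exact: W|move=> *; apply/esym/W].
move=> qs qt; congr (fine (mu _)); apply/seteqP; split=> x [/=].
  rewrite !in_itv/= => /andP[sx x2] nO; split => //=; rewrite in_itv/= x2 andbT.
  rewrite leNgt; apply/negP => xt; apply: nO; apply: dO.
  by move: qs qt; rewrite /ball/= !ltr_norml; lra.
rewrite !in_itv/= => /andP[tx x2] nO; split => //=; rewrite in_itv/= x2 andbT.
exact: le_trans tx.
Qed.

End Staircase.

(** * The twist *)

Section PathLength.
Context {R : realType}.
Implicit Types (f : R -> plane R) (s t d : R).

(** Along an increasing partition the absolute values drop and the distances telescope from 0 to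
    1. *)
Lemma itv_partition_sum_edist f (d : R) (s : seq R) : itv_partition 0 1 s ->
  (forall r t, 0 <= r <= 1 -> 0 <= t <= 1 -> edist (f r) (f t) = `|r - t| * d) ->
  \sum_(0 <= n < size s)
    edist (f (nth 1 (0 :: s) n)) (f (nth 1 (0 :: s) n.+1)) = d.
Proof.
move=> [ps /eqP ls] fd.
pose x n := nth 1 (0 :: s) n.
have sle : sorted <=%O (0 :: s) by apply: sub_path ps => y z; exact: ltW.
have xle i j : (i <= j <= size s)%N -> x i <= x j.
  move=> /andP[ij js]; apply: (sorted_leq_nth le_trans (@lexx _ _) 1 sle) => //.
  by rewrite inE ltnS (leq_trans ij).
have xs : x (size s) = 1 by rewrite /x -ls -last_nth.
have x01 i : (i <= size s)%N -> 0 <= x i <= 1.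
  move=> ir; have := xle 0%N i; have := xle i (size s).
  by rewrite leqnn ir /= xs => -> // ->.
transitivity (\sum_(0 <= n < size s) (x n.+1 * d - x n * d)).
  apply: eq_big_nat => n /andP[_ ns].
  rewrite fd ?x01// ?(ltnW ns)// distrC ger0_norm ?mulrBl//.
  by rewrite subr_ge0 xle// leqnSn.
by rewrite telescope_sumr// xs /x /= mul1r mul0r subr0.
Qed.

(** All inscribed polygons have length [d], so the supremum is over a singleton. *)
Lemma path_length_affine f d :
  (forall r t, 0 <= r <= 1 -> 0 <= t <= 1 -> edist (f r) (f t) = `|r - t| * d) ->
  path_length 0 1 f = d%:E.
Proof.
move=> fd; rewrite /path_length [X in ereal_sup X](_ : _ = [set d%:E]).
  exact: ereal_sup1.
apply/seteqP; split=> [_ [s ps <-]|_ ->] /=.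
  by rewrite (itv_partition_sum_edist ps fd).
have p1 : itv_partition (0 : R) 1 [:: 1] by rewrite /itv_partition /= ltr01.
by exists [:: 1] => //; rewrite (itv_partition_sum_edist p1 fd).
Qed.

Lemma edist_affine_path (a b : plane R) s t :
  edist (affine_path a b s) (affine_path a b t) = `|s - t| * edist a b.
Proof.
rewrite /edist -sqrtr_sqr -sqrtrM ?sqr_ge0//; congr Num.sqrt.
by rewrite !affine_pathE /=; ring.
Qed.

End PathLength.

(** * Rotations, and isometries on dense sets *)

Section Rotation.
Context {R : realType}.
Implicit Types (v w a b : plane R) (s t : R).

Definition rotation t v : plane R :=
  (cos t * v.1 - sin t * v.2, sin t * v.1 + cos t * v.2).

Definition sqnorm v : R := v.1 ^+ 2 + v.2 ^+ 2.

Lemma rotation0 v : rotation 0 v = v.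
Proof. by apply: planeP; rewrite /rotation cos0 sin0 /=; ring. Qed.

Lemma sqnorm_rotation t v : sqnorm (rotation t v) = sqnorm v.
Proof.
transitivity ((cos t ^+ 2 + sin t ^+ 2) * sqnorm v).
  by rewrite /sqnorm /rotation /=; ring.
by rewrite cos2Dsin2 mul1r.
Qed.

Lemma edist_rotation t v w : edist (rotation t v) (rotation t w) = edist v w.
Proof.
rewrite /edist; congr Num.sqrt.
transitivity ((cos t ^+ 2 + sin t ^+ 2) * ((v.1 - w.1) ^+ 2 + (v.2 - w.2) ^+ 2)).
  by rewrite /rotation /=; ring.
by rewrite cos2Dsin2 mul1r.
Qed.

(** The relation between the angles is a premise so that the lemma also applies when [s] is only
    provably equal to [- t], as in [twistNK]. *)
Lemma rotationNK s t v : s = - t -> rotation s (rotation t v) = v.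
Proof.
move=> ->; apply: planeP; rewrite /rotation cosN sinN /=.
  transitivity ((cos t ^+ 2 + sin t ^+ 2) * v.1); first by ring.
  by rewrite cos2Dsin2 mul1r.
transitivity ((cos t ^+ 2 + sin t ^+ 2) * v.2); first by ring.
by rewrite cos2Dsin2 mul1r.
Qed.

Lemma continuous_rotation (T : topologicalType) (f : T -> R) (g : T -> plane R) :
  continuous f -> continuous g -> continuous (fun i => rotation (f i) (g i)).
Proof.
move=> cf cg.
have cc : continuous (fun i => cos (f i)).
  by move=> i; apply: continuous_comp; [exact: cf|exact: continuous_cos].
have cs : continuous (fun i => sin (f i)).
  by move=> i; apply: continuous_comp; [exact: cf|exact: continuous_sin].
have c1 : continuous (fun i => (g i).1).
  by move=> i; apply: continuous_comp; [exact: cg|exact: cvg_fst].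
have c2 : continuous (fun i => (g i).2).
  by move=> i; apply: continuous_comp; [exact: cg|exact: cvg_snd].
apply: continuous_pair => i.
  by apply: cvgB; apply: cvgM; [exact: cc|exact: c1|exact: cs|exact: c2].
by apply: cvgD; apply: cvgM; [exact: cs|exact: c1|exact: cc|exact: c2].
Qed.

Lemma continuous_sqnorm : continuous sqnorm.
Proof.
move=> v; apply: cvgD; apply: cvgM;
  [exact: cvg_fst|exact: cvg_fst|exact: cvg_snd|exact: cvg_snd].
Qed.

Lemma edist_sqr v w : edist v w ^+ 2 = (v.1 - w.1) ^+ 2 + (v.2 - w.2) ^+ 2.
Proof. by rewrite sqr_sqrtr// addr_ge0 ?sqr_ge0. Qed.

(** The defect [F] of squared distances is continuous on pairs of points and vanishes on pairs from
    [A], which are dense. *)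
Lemma dense_isometry (A : set (plane R)) (f g : plane R -> plane R) : dense A ->
  continuous f -> isometry_on setT g -> (forall x, A x -> f x = g x) ->
  isometry_on setT f.
Proof.
move=> dA cf ig fg x y _ _.
pose D (z : plane R * plane R) := (z.1.1 - z.2.1) ^+ 2 + (z.1.2 - z.2.2) ^+ 2.
have cD : continuous D.
  move=> z; apply: cvgD; apply: cvgM; apply: cvgB;
    apply: continuous_comp; try exact: cvg_fst; try exact: cvg_snd.
pose F z := D (f z.1, f z.2) - D z.
have cF : continuous F.
  move=> z; apply: cvgB; last exact: cD.
  have c1 : {for z, continuous (fun w : plane R * plane R => f w.1)}.
    by apply: continuous_comp; [exact: cvg_fst|exact: cf].
  have c2 : {for z, continuous (fun w : plane R * plane R => f w.2)}.
    by apply: continuous_comp; [exact: cvg_snd|exact: cf].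
  exact: (continuous_comp (cvg_pair c1 c2) (cD _)).
suff F0 : F (x, y) = 0.
  by rewrite /edist; congr Num.sqrt; move: F0; rewrite /F /D /=; lra.
apply: contrapT => /eqP F0.
have /nbhs_ballP[e /= e0 eF] : nbhs (x, y) (F @^-1` [set r | r != 0]).
  by apply: cF; apply: open_nbhs_nbhs; split => //; exact: open_neq.
have near z : exists2 z', ball z e z' & A z'.
  by have [|z' []] := dA (ball z e) _ (ball_open _ _);
    [by exists z; exact: ballxx|exists z'].
have [x' xx' Ax'] := near x; have [y' yy' Ay'] := near y.
have /eqP := eF (x', y') (conj xx' yy'); apply; rewrite /F /D /= !fg//.
by have := ig x' y' I I => /(congr1 (fun r => r ^+ 2)); rewrite !edist_sqr; lra.
Qed.

End Rotation.

(** * The twist as a rod-pin flex *)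

Section TwistFlex.
Context {R : realType}.
Variable c : R -> R.
Hypothesis continuous_c : continuous c.
Hypothesis c_ge2 : forall s, 2 <= s -> c s = 0.
Hypothesis c1_itv : 0 < c 1 <= 1.
Implicit Types (v w x y a b : plane R) (s t : R) (l : set (plane R)).

Definition twist t v := rotation (t * c (sqnorm v)) v.

Definition twist_cells : set (set (plane R)) :=
  [set U | open U /\ exists s, forall v, U v -> c (sqnorm v) = s].

Lemma continuous_twist : continuous (uncurry twist).
Proof.
have -> : uncurry twist =
    fun i : R * plane R => rotation (i.1 * c (sqnorm i.2)) i.2.
  by apply/funext => -[].
apply: continuous_rotation => i; last exact: cvg_snd.
apply: cvgM; first exact: cvg_fst.
apply: continuous_comp; last exact: continuous_c.
by apply: continuous_comp; [exact: cvg_snd|exact: continuous_sqnorm].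
Qed.

Lemma continuous_twist_space t : continuous (twist t).
Proof.
have cp : continuous (fun w : plane R => (t, w)).
  by move=> w; exact: (cvg_pair (cvg_cst _) cvg_id).
by move=> v; exact: (continuous_comp (cp v) (@continuous_twist (t, v))).
Qed.

Lemma continuous_twist_time v : continuous (twist ^~ v).
Proof.
have cp : continuous (fun s : R => (s, v)).
  by move=> s; exact: (cvg_pair cvg_id (cvg_cst _)).
by move=> t; exact: (continuous_comp (cp t) (@continuous_twist (t, v))).
Qed.

(** Rotations preserve [sqnorm], so [twist (- t)] uses the opposite angle at the image point. *)
Lemma twistNK t : cancel (twist t) (twist (- t)).
Proof. by move=> v; rewrite /twist sqnorm_rotation rotationNK// mulNr. Qed.

Lemma twist_homeomorphism t : homeomorphism (twist t).
Proof.
exists (twist (- t)); split; try exact: continuous_twist_space.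
  exact: twistNK.
by rewrite -{2}[t]opprK; exact: twistNK.
Qed.

Lemma twist0 v : twist 0 v = v.
Proof. by rewrite /twist mul0r rotation0. Qed.

(** The ball is a sup-norm square: a point with [sqnorm] below 2 has both coordinates below 2 in
    absolute value, so outside the square [c] vanishes. *)
Lemma twist_outside t v : ~ ball (0 : plane R) 2 v -> twist t v = v.
Proof.
move=> nv; rewrite /twist c_ge2 ?mulr0 ?rotation0// /sqnorm.
apply: contrapT => /negP; rewrite -ltNge => lt2; apply: nv.
have h (r s : R) : r ^+ 2 + s ^+ 2 < 2 -> `|0 - r| < 2.
  by move=> h; rewrite sub0r normrN ltr_norml; apply/andP; split; nra.
by split; [exact: h lt2|rewrite addrC in lt2; exact: h lt2].
Qed.

Lemma twist_cell_isometry l t : (exists2 U, twist_cells U & l `<=` U) ->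
  isometry_on l (twist t).
Proof.
move=> [U [_ [s Us]] lU] x y lx ly.
by rewrite /twist (Us _ (lU _ lx)) (Us _ (lU _ ly)) edist_rotation.
Qed.

(** A subsegment of a string lies in the same cell, so it moves isometrically and keeps its length
    by [path_length_affine]. *)
Lemma twist_flex M :
  (forall l, strings M l ->
    (exists a b, l = segment a b) /\ exists2 U, twist_cells U & l `<=` U) ->
  rod_pin_flex M twist.
Proof.
move=> hM; split; last first.
  by move=> t l _ /hM[_ lU]; exact: twist_cell_isometry.
split=> [t t01|x _|x _].
- split=> [x y _ _ /(can_inj (twistNK t))//|l _|l a b Ml la lb].
    exact/continuous_subspaceT/continuous_twist_space.
  have [[a' [b' lE]] lU] := hM _ Ml.
  have lab r : 0 <= r <= 1 -> l (affine_path a b r).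
    move=> r01; move: la lb; rewrite lE => la lb.
    by apply: (segment_convex la lb); exists r.
  apply: path_length_affine => r s r01 s01 /=.
  by rewrite (twist_cell_isometry t lU)// ?edist_affine_path//; exact: lab.
- exact: twist0.
- exact/continuous_subspaceT/continuous_twist_time.
Qed.

(** The point (2, 0) is fixed while (1, 0) turns by the angle [c 1], between 0 and pi. The squared
    distance grows from 1 to 5 - 4 cos ([c 1]). *)
Lemma twist_not_isometry : exists x y, edist (twist 1 x) (twist 1 y) <> edist x y.
Proof.
exists (2, 0), (1, 0) => /(congr1 (fun r => r ^+ 2)).
have -> : twist 1 (2, 0) = (2, 0).
  by rewrite /twist c_ge2 ?mulr0 ?rotation0//= /sqnorm /=; lra.
have -> : twist 1 (1, 0) = (cos (c 1), sin (c 1)).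
  have -> : twist 1 (1, 0) = rotation (c 1) (1, 0).
    by rewrite /twist mul1r /sqnorm /= expr1n expr0n addr0.
  by apply: planeP; rewrite /rotation /=; ring.
rewrite !edist_sqr /=.
have /andP[c0 c1] := c1_itv.
have pi2 := pi_ge2 R.
have : cos (c 1) < 1.
  by rewrite -[X in _ < X](@cos0 R) ltr_cos// in_itv/= ?lexx ?pi_ge0//; lra.
by have := cos2Dsin2 (c 1); nra.
Qed.

End TwistFlex.

(** A point with rational coordinates has rational [sqnorm], near which [c] is constant; pulling
    that neighbourhood back gives a cell around the point. *)
Lemma dense_twist_cells (R : realType) (c : R -> R) :
  (forall q : rat, exists2 d, 0 < d & forall s t,
    ball (ratr q : R) d s -> ball (ratr q : R) d t -> c s = c t) ->
  dense (\bigcup_(U in twist_cells c) U).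
Proof.
move=> cq V V0 oV; have [q1 [q2 Vq]] := open_plane_rat oV V0.
have [d d0 cd] := cq (q1 ^+ 2 + q2 ^+ 2).
set B := ball _ d in cd.
have BN : B (sqnorm (ratr q1, ratr q2)).
  by rewrite /sqnorm /= -!rmorphXn -rmorphD; exact: ballxx.
exists (ratr q1, ratr q2); split => //; exists (sqnorm @^-1` B) => //; split.
  by move/continuousP: (@continuous_sqnorm R); apply; exact: ball_open.
by exists (c (ratr (q1 ^+ 2 + q2 ^+ 2))) => v /cd; apply; exact: ballxx.
Qed.

Theorem theorem5p7 (R : realType) (r : nat) (hr : (3 <= r)%N) :
  exists M : rod_pin_mesh R,
    locally_flexible M /\ dense_mesh M /\
    forall x : plane R, nodes M x -> has_degree M x r.
Proof.
have [c [cc c2 c1 cq]] := @staircase R.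
(* A node has two rays from the crossing string, so [r - 2] spokes remain, at least one since [r] is
   at least 3. *)
have [k k0 rE] : exists2 k, (0 < k)%N & r = k.+2.
  by exists r.-2; [case: r hr => [|[|[|]]]|case: r hr => [|[|]]].
have [|M [dM degM strM]] := cell_mesh _ (dense_twist_cells cq) k0.
  by move=> U [].
exists M; rewrite rE; split => //.
exists (ball (0 : plane R) 2), (twist c); split.
- exact: ball_open.
- exists 2; split => // s s2 x /=; rewrite prod_norm_ball /ball_ /= sub0r normrN.
  by move=> x2; exact/ltW/(lt_trans x2).
- split=> [t _|]; first exact: twist_homeomorphism.
  exact/continuous_subspaceT/continuous_twist.
- split; first exact: twist_flex.
  move=> triv; have [|g [ig gE]] := triv 1; first by rewrite ler01 lexx.
  (* An isometry agreeing with [twist c 1] on the dense body would, by continuity, make the twist an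
     isometry of the whole plane. *)
  have [x [y]] := twist_not_isometry c2 c1; apply.
  have body_dense : dense (body M).
    move=> V V0 oV; have [z [Vz]] := dM V V0 oV.
    by rewrite nodesE => -[l [_ [Ml _ _ lz _]]]; exists z; split => //; exists l.
  have ct : continuous (twist c 1) by exact: continuous_twist_space.
  exact: (dense_isometry body_dense ct ig gE).
- by move=> t x _; exact: twist_outside.
Qed.
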